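(* Let $R$ be a left artinian complete hemiring. Then $R$ is congruence-simple if and only if $|R|\le 2$, or $R$ is isomorphic to a dense complete subhemiring $S\subseteq \mathrm{CEnd}_{\mathbf{B}}(M)$ of the complete endomorphism hemiring $\mathrm{CEnd}_{\mathbf{B}}(M)$ of a nonzero complete noetherian lattice $M$.
   Context: A hemiring $(R,+,\cdot,0)$ consists of a commutative monoid $(R,+,0)$ and a semigroup $(R,\cdot)$ such that multiplication distributes over addition on both sides and $0r=0=r0$ for all $r$. A hemiring $R$ is complete if for every index set $\Omega$ and every family $(m_i)_{i\in\Omega}$ in $R$ an element $\sum_{i\in\Omega}m_i\in R$ is given such that: the sum over $\emptyset$ is $0$; $\sum_{i\in\{1\}}m_i=m_1$; $\sum_{i\in\{1,2\}}m_i=m_1+m_2$; $\sum_{i\in\Omega}m_i=\sum_{j\in\Lambda}\big(\sum_{i\in\Omega_j}m_i\big)$ for every partition $\Omega=\bigcup_{j\in\Lambda}\Omega_j$ into disjoint nonempty subsets; and $r\big(\sum_{i\in\Omega}m_i\big)=\sum_{i\in\Omega}rm_i$, $\big(\sum_{i\in\Omega}m_i\big)r=\sum_{i\in\Omega}m_ir$ for all $r\in R$. Complete homomorphisms of complete hemirings are hemiring homomorphisms preserving all these sums, and isomorphism of complete hemirings is meant in this sense; a complete subhemiring is a subhemiring closed under all these sums. $R$ is left artinian if its left ideals (additive submonoids closed under left multiplication by $R$) satisfy the descending chain condition. $R$ is congruence-simple if the diagonal and $R^2$ are its only congruences. A lattice is noetherian if it satisfies the ascending chain condition on elements. For a complete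 lattice $M$ with least element $0$, $\mathrm{CEnd}_{\mathbf{B}}(M)$ is the set of all maps $M\to M$ preserving arbitrary joins (including the empty join $0$), which is a complete hemiring under pointwise sums (joins) and composition. For $a,b\in M$, $e_{a,b}:M\to M$ is given by $e_{a,b}(x)=0$ if $x\le a$ and $e_{a,b}(x)=b$ otherwise; a subhemiring $S$ of $\mathrm{CEnd}_{\mathbf{B}}(M)$ is dense if $e_{a,b}\in S$ for all $a,b\in M$. *)

(* Defs.v *)
From HB Require Import structures.
From mathcomp Require Import all_boot all_order all_algebra.
From mathcomp Require Import boolp classical_sets functions cardinality.

Set Implicit Arguments.
Unset Strict Implicit.
Unset Printing Implicit Defensive.

Import Order.TTheory GRing.Theory.
Local Open Scope classical_set_scope.
Local Open Scope ring_scope.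

(* MathComp's semirings are unital, so a hemiring combines its commutative
   monoids (additive notation, [+%R]) with its semigroups
   (multiplicative notation, in [group_scope]). *)
HB.mixin Record isHemiring R of GRing.Nmodule R & Semigroup R := {
  hmulDl : forall x y z : R, ((x + y)%R * z)%g = (x * z)%g + (y * z)%g;
  hmulDr : forall x y z : R, (x * (y + z)%R)%g = (x * y)%g + (x * z)%g;
  hmul0r : forall x : R, ((0%R : R) * x)%g = 0;
  hmulr0 : forall x : R, (x * (0%R : R))%g = 0
}.

#[short(type="hemiringType")]
HB.structure Definition Hemiring :=
  { R of GRing.Nmodule R & Semigroup R & isHemiring R }.

(* Index sets are arbitrary types.  The laws for the index sets {}, {1} and
   {1, 2} are stated for every index type with no, one or two elements, so that
   (with [csum_partition]) sums are invariant under reindexing; the blocks of a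
   partition are sets, coerced to types. *)
HB.mixin Record isCompleteHemiring R of Hemiring R := {
  csum : forall I : Type, (I -> R) -> R;
  csum_empty : forall (I : Type) (m : I -> R),
    (I -> False) -> csum I m = 0;
  csum_single : forall (I : Type) (m : I -> R) (i : I),
    (forall k, k = i) -> csum I m = m i;
  csum_pair : forall (I : Type) (m : I -> R) (i j : I),
    i <> j -> (forall k, k = i \/ k = j) -> csum I m = m i + m j;
  csum_partition : forall (I J : Type) (m : I -> R) (F : J -> set I),
    partition [set: J] F [set: I] ->
    csum I m = csum J (fun j => csum (F j) (fun i : F j => m (set_val i)));
  hmul_csumr : forall (I : Type) (m : I -> R) (r : R),
    (r * csum I m)%g = csum I (fun i => (r * m i)%g);
  hmul_csuml : forall (I : Type) (m : I -> R) (r : R),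
    (csum I m * r)%g = csum I (fun i => (m i * r)%g)
}.

#[short(type="completeHemiringType")]
HB.structure Definition CompleteHemiring :=
  { R of Hemiring R & isCompleteHemiring R }.

Arguments csum {R I} m : rename.

Section HemiringDefs.
Variable R : hemiringType.

Definition left_ideal (L : set R) : Prop :=
  [/\ L 0, (forall x y, L x -> L y -> L (x + y)) &
      (forall r x, L x -> L (r * x)%g)].

Definition left_artinian : Prop :=
  forall L : nat -> set R,
    (forall n, left_ideal (L n)) ->
    (forall n, L n.+1 `<=` L n) ->
    exists N, forall n, (N <= n)%N -> L n = L N.

Definition congruence (e : R -> R -> Prop) : Prop :=
  [/\ (forall x, e x x),
      (forall x y, e x y -> e y x),
      (forall x y z, e x y -> e y z -> e x z),
      (forall x x' y y', e x x' -> e y y' -> e (x + y) (x' + y')) &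
      (forall x x' y y', e x x' -> e y y' -> e (x * y)%g (x' * y')%g)].

Definition congruence_simple : Prop :=
  forall e : R -> R -> Prop, congruence e ->
    (forall x y, e x y <-> x = y) \/ (forall x y, e x y).

Definition subhemiring (S : set R) : Prop :=
  [/\ S 0, (forall x y, S x -> S y -> S (x + y)) &
      (forall x y, S x -> S y -> S (x * y)%g)].

End HemiringDefs.

Definition complete_subhemiring (R : completeHemiringType) (S : set R) : Prop :=
  subhemiring S /\
  forall (I : Type) (m : I -> R), (forall i, S (m i)) -> S (csum m).

Definition complete_hom (R R' : completeHemiringType) (f : R -> R') : Prop :=
  [/\ f 0 = 0, {morph f : x y / (x + y)}, {morph f : x y / (x * y)%g} &
      (forall (I : Type) (m : I -> R), f (csum m) = csum (f \o m))].

(* For a complete subhemiring [S] of [R'] (whose operations and sums are those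
   of [R']): [R] and [S] are isomorphic complete hemirings. *)
Definition complete_isomorphic (R R' : completeHemiringType) (S : set R') :
    Prop :=
  exists f : R -> R', complete_hom f /\ set_bij [set: R] S f.

HB.mixin Record isCompleteLattice d M of Order.TBLattice d M := {
  csup : set M -> M;
  cinf : set M -> M;
  csupP : forall A : set M, supremums A (csup A);
  cinfP : forall A : set M, infimums A (cinf A)
}.

#[short(type="completeLatticeType")]
HB.structure Definition CompleteLattice d :=
  { M of Order.TBLattice d M & isCompleteLattice d M }.

Definition noetherian d (M : latticeType d) : Prop :=
  forall u : nat -> M, (forall n, u n <= u n.+1)%O ->
    exists N, forall n, (N <= n)%N -> u n = u N.

Section CompleteLatticeTheory.
Variables (d : Order.disp_t) (M : completeLatticeType d).
Implicit Types (A : set M) (x y : M).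

Lemma csup_le A x : (csup A <= x)%O <-> (forall y, A y -> (y <= x)%O).
Proof.
have [ubA lubA] := csupP A; split=> [Ax y Ay|]; last exact: lubA.
exact: le_trans (ubA _ Ay) Ax.
Qed.

Lemma csup_eq A x :
  (forall z, (x <= z)%O <-> (forall y, A y -> (y <= z)%O)) -> csup A = x.
Proof.
move=> xP; apply/le_anti/andP; split; first exact/csup_le/xP.
exact/xP/csup_le.
Qed.

Lemma csup0 : csup set0 = \bot%O :> M.
Proof. by apply: csup_eq => z; split. Qed.

End CompleteLatticeTheory.

Record cend d (M : completeLatticeType d) := CEnd {
  cend_fun :> M -> M;
  cend_csup : forall A : set M, cend_fun (csup A) = csup (cend_fun @` A)
}.

Section CEnd.
Variables (d : Order.disp_t) (M : completeLatticeType d).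
Local Notation E := (cend M).
Implicit Types (f g h : E) (x y : M).

Lemma cendP f g : f =1 g -> f = g.
Proof.
case: f g => [f fP] [g gP] /= /funext fg.
by case: g / fg gP => gP; congr CEnd; apply: Prop_irrelevance.
Qed.

Lemma cend0 f : f \bot%O = \bot%O.
Proof. by rewrite -csup0 cend_csup image_set0. Qed.

Lemma cendU f x y : f (x `|` y)%O = (f x `|` f y)%O.
Proof.
have -> : (x `|` y)%O = csup [set x; y].
  apply/esym/csup_eq => z; rewrite leUx; split=> [/andP[xz yz] w [->//|->//]|le].
  by rewrite !le //; [right|left].
rewrite cend_csup; apply: csup_eq => z; rewrite leUx; split=> [/andP[xz yz]|le].
  by move=> w [v [->|->] <-].
by apply/andP; split; apply: le; [exists x|exists y] => //; [left|right].
Qed.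

Lemma cend_bot_subproof (A : set M) :
  (fun=> \bot%O) (csup A) = csup ((fun=> \bot%O : M) @` A).
Proof.
by apply/esym/csup_eq => z; split=> [le _ [_ _ <-]|_]; rewrite le0x.
Qed.

Lemma cend_join_subproof f g (A : set M) :
  (f (csup A) `|` g (csup A))%O = csup ((fun x => f x `|` g x)%O @` A).
Proof.
apply/esym/csup_eq => z; rewrite leUx !cend_csup; split.
  move=> /andP[/csup_le lef /csup_le leg] _ [x Ax <-].
  by rewrite leUx lef ?leg //; exists x.
move=> le; apply/andP; split; apply/csup_le => _ [x Ax <-].
  by have := le _ (ex_intro2 _ _ x Ax erefl); rewrite leUx => /andP[].
by have := le _ (ex_intro2 _ _ x Ax erefl); rewrite leUx => /andP[].
Qed.

Lemma cend_comp_subproof f g (A : set M) :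
  f (g (csup A)) = csup ((fun x => f (g x)) @` A).
Proof. by rewrite !cend_csup image_comp. Qed.

Lemma cend_sup_subproof (I : Type) (m : I -> E) (A : set M) :
  csup (range (fun i => m i (csup A))) =
  csup ((fun x => csup (range (fun i => m i x))) @` A).
Proof.
apply/csup_eq => z; split=> [/csup_le le _ [i _ <-]|le].
  rewrite cend_csup; apply/csup_le => _ [x Ax <-].
  by apply: (csup_le _ _).1 (le _ (ex_intro2 _ _ x Ax erefl)) _ _; exists i.
apply/csup_le => _ [x Ax <-]; apply/csup_le => _ [i _ <-].
have := le _ (ex_intro2 _ _ i Logic.I erefl); rewrite cend_csup => /csup_le; apply.
by exists x.
Qed.

Definition cend_bot : E := CEnd cend_bot_subproof.
Definition cend_join f g : E := CEnd (cend_join_subproof f g).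
Definition cend_comp f g : E := CEnd (cend_comp_subproof f g).
Definition cend_sup (I : Type) (m : I -> E) : E := CEnd (cend_sup_subproof m).

Lemma cend_joinA : associative cend_join.
Proof. by move=> f g h; apply: cendP => x /=; rewrite joinA. Qed.

Lemma cend_joinC : commutative cend_join.
Proof. by move=> f g; apply: cendP => x /=; rewrite joinC. Qed.

Lemma cend_join0 : left_id cend_bot cend_join.
Proof. by move=> f; apply: cendP => x /=; rewrite join0x. Qed.

Lemma cend_compA : associative cend_comp.
Proof. by move=> f g h; apply: cendP. Qed.

Lemma cend_supP (I : Type) (m : I -> E) x z :
  (cend_sup m x <= z)%O <-> (forall i, (m i x <= z)%O).
Proof.
split=> [/csup_le le i|le]; first by apply: le; exists i.
by apply/csup_le => _ [i _ <-].
Qed.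

Lemma cend_sup_eq (I : Type) (m : I -> E) f :
  (forall x z, (f x <= z)%O <-> (forall i, (m i x <= z)%O)) -> cend_sup m = f.
Proof.
move=> fP; apply: cendP => x; apply: le_anti; apply/andP; split.
  exact/cend_supP/fP.
exact/fP/cend_supP.
Qed.

End CEnd.

HB.instance Definition _ d (M : completeLatticeType d) :=
  gen_eqMixin (cend M).
HB.instance Definition _ d (M : completeLatticeType d) :=
  gen_choiceMixin (cend M).
HB.instance Definition _ d (M : completeLatticeType d) :=
  GRing.isNmodule.Build (cend M) (@cend_joinA d M) (@cend_joinC d M)
    (@cend_join0 d M).
HB.instance Definition _ d (M : completeLatticeType d) :=
  isSemigroup.Build (cend M) (@cend_compA d M).

Section CEndHemiring.
Variables (d : Order.disp_t) (M : completeLatticeType d).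
Local Notation E := (cend M).

Fact cend_mulDl (f g h : E) : ((f + g)%R * h)%g = (f * h)%g + (g * h)%g.
Proof. exact: cendP. Qed.

Fact cend_mulDr (f g h : E) : (f * (g + h)%R)%g = (f * g)%g + (f * h)%g.
Proof. by apply: cendP => x /=; rewrite cendU. Qed.

Fact cend_mul0r (f : E) : ((0%R : E) * f)%g = 0.
Proof. exact: cendP. Qed.

Fact cend_mulr0 (f : E) : (f * (0%R : E))%g = 0.
Proof. by apply: cendP => x /=; rewrite cend0. Qed.

HB.instance Definition _ :=
  isHemiring.Build E cend_mulDl cend_mulDr cend_mul0r cend_mulr0.

Fact cend_sup_empty (I : Type) (m : I -> E) : (I -> False) -> cend_sup m = 0.
Proof.
move=> nI; apply: cend_sup_eq => x z.
by split=> [_ i|_]; [case: (nI i)|exact: le0x].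
Qed.

Fact cend_sup_single (I : Type) (m : I -> E) (i : I) :
  (forall k, k = i) -> cend_sup m = m i.
Proof.
by move=> Ii; apply: cend_sup_eq => x z; split=> [le k|]; [rewrite (Ii k)|apply].
Qed.

Fact cend_sup_pair (I : Type) (m : I -> E) (i j : I) :
  i <> j -> (forall k, k = i \/ k = j) -> cend_sup m = m i + m j.
Proof.
move=> _ Iij; apply: cend_sup_eq => x z; rewrite leUx.
split=> [/andP[lei lej] k|le].
  by case: (Iij k) => ->.
by rewrite !le.
Qed.

Fact cend_sup_partition (I J : Type) (m : I -> E) (F : J -> set I) :
  partition [set: J] F [set: I] ->
  cend_sup m = cend_sup (fun j => cend_sup (fun i : F j => m (set_val i))).
Proof.
move=> [FI _ _]; apply: cend_sup_eq => x z; split=> [/cend_supP le i|le].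
  have [j _ Fji] : cover [set: J] F i by rewrite FI.
  exact: (cend_supP _ _ _).1 (le j) (SigSub (mem_set Fji)).
by apply/cend_supP => j; apply/cend_supP => i; apply: le.
Qed.

Fact cend_comp_supr (I : Type) (m : I -> E) (f : E) :
  (f * cend_sup m)%g = cend_sup (fun i => (f * m i)%g).
Proof.
apply/esym/cend_sup_eq => x z /=; rewrite cend_csup; split=> [/csup_le le i|le].
  by apply: le; exists (m i x) => //; exists i.
by apply/csup_le => _ [_ [i _ <-] <-]; apply: le.
Qed.

Fact cend_comp_supl (I : Type) (m : I -> E) (f : E) :
  (cend_sup m * f)%g = cend_sup (fun i => (m i * f)%g).
Proof. exact: cendP. Qed.

HB.instance Definition _ :=
  isCompleteHemiring.Build E cend_sup_empty cend_sup_single cend_sup_pair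
    cend_sup_partition cend_comp_supr cend_comp_supl.

Lemma cend_e_subproof (a b : M) (A : set M) :
  (if (csup A <= a)%O then \bot%O else b) =
  csup ((fun x => if (x <= a)%O then \bot%O else b) @` A).
Proof.
apply/esym/csup_eq => z; case: ifPn => [/csup_le leA|Aa].
  by rewrite le0x; split=> // _ _ [x Ax <-]; rewrite leA.
split=> [bz _ [x _ <-]|le]; first by case: ifP => _; rewrite ?le0x.
have [[x Ax xa]|nA] := pselect (exists2 x, A x & ~~ (x <= a)%O).
  by have := le _ (ex_intro2 _ _ x Ax erefl); rewrite (negbTE xa).
case/negP: Aa; apply/csup_le => x Ax; apply: contrapT => /negP xa.
by apply: nA; exists x.
Qed.

Definition cend_e (a b : M) : E := CEnd (cend_e_subproof a b).

Definition cend_dense (S : set E) : Prop := forall a b : M, S (cend_e a b).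

End CEndHemiring.

(* Main.v *)
(* Comparing K-fold sums shows that in a complete congruence-simple hemiring
   every constant family over an inhabited index set sums to its value, so that
   sums behave as suprema. Comparing left multiples [r * x] shows that, unless
   R has at most two elements, R x = 0 only for x = 0. A minimal complete left
   ideal L then satisfies K x = 0 or K x = L for every complete left ideal K and
   x in L. R acts on the lattice M of annihilators of elements of L: the action
   is faithful by simplicity, M is noetherian since an ascending chain in M is a
   descending chain of left ideals, and the sum of the annihilator of x followed
   by an element sending the top of L to y acts as e_{ann x, ann y}. *)
Require Import Defs.
From HB Require Import structures.
From mathcomp Require Import all_boot all_order all_algebra.
From mathcomp Require Import boolp classical_sets functions cardinality.

Set Implicit Arguments.
Unset Strict Implicit.
Unset Printing Implicit Defensive.

Local Open Scope classical_set_scope.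
Local Open Scope card_scope.

Import Order.TTheory GRing.Theory.

(** * Sums over arbitrary index types *)

Section CompleteSums.
Variable R : completeHemiringType.
Implicit Types x y : R.
Local Open Scope ring_scope.

Lemma csum_zero I : csum (fun _ : I => 0 : R) = 0.
Proof.
rewrite -[RHS](hmul0r (csum (fun _ : I => 0 : R))) hmul_csumr.
by congr csum; apply: funext => i; rewrite hmul0r.
Qed.

(** The singletons [[set h j]] partition [I]. *)
Lemma csum_reindex I J (h : J -> I) (m : I -> R) :
  injective h -> (forall i, exists j, h j = i) -> csum m = csum (m \o h).
Proof.
move=> h_inj h_surj; rewrite (csum_partition _ _ m (fun j => [set h j])).
  congr csum; apply: funext => j; pose k : [set h j] := SigSub (mem_set erefl).
  rewrite (csum_single _ _ k) // => -[i hi]; apply: val_inj => /=.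
  exact: set_mem hi.
split=> [|j k _ _ [i [-> /h_inj]] //|j _]; last by exists (h j).
by apply/seteqP; split=> // i _; have [j <-] := h_surj i; exists j.
Qed.

(** This form of the partition law has types as blocks instead of subsets. They must be inhabited
    because partitions have nonempty blocks. *)
Lemma csum_blocks {I J} {K : J -> Type} (h : forall j, K j -> I) (m : I -> R) :
    (forall j, inhabited (K j)) -> (forall j, injective (h j)) ->
    (forall j j' k k', h j k = h j' k' -> j = j') ->
    (forall i, exists j k, h j k = i) ->
  csum m = csum (fun j => csum (fun k : K j => m (h j k))).
Proof.
move=> K0 h_inj hJ h_surj.
rewrite (csum_partition _ _ m (fun j => range (h j))).
  congr csum; apply: funext => j.
  pose g k : range (h j) := SigSub (mem_set (imageT (h j) k)).
  rewrite (csum_reindex (h := g)) // => [k k' /(congr1 val)|[i hi]].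
    exact: h_inj.
  by have [k _ hk] := set_mem hi; exists k; apply: val_inj.
split=> [|j j' _ _ [i [[k _ <-] [k' _ /esym/hJ]]] //|j _].
  apply/seteqP; split=> // i _; have [j [k <-]] := h_surj i.
  by exists j => //; exists k.
by have [k] := K0 j; exists (h j k), k.
Qed.

Lemma csum_prod I K (m : I -> K -> R) : inhabited K ->
  csum (fun p : I * K => m p.1 p.2) = csum (fun i => csum (m i)).
Proof.
move=> K0; rewrite (csum_blocks (h := fun (i : I) (k : K) => (i, k))) // =>
  [i k k' []|i i' k k' []|] //.
by case=> i k; exists i, k.
Qed.

Lemma csum_exchange I K (m : I -> K -> R) : inhabited I -> inhabited K ->
  csum (fun i => csum (m i)) = csum (fun k => csum (m^~ k)).
Proof.
move=> I0 K0; rewrite -csum_prod // -(csum_prod (fun k i => m i k)) //.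
rewrite (csum_reindex (h := (fun p : K * I => (p.2, p.1)))) // => [|[i k]].
  by case=> k i [k' i'] [-> ->].
by exists (k, i).
Qed.

Lemma csum_bool (m : bool -> R) : csum m = m true + m false.
Proof. by apply: csum_pair => // -[]; [left|right]. Qed.

Lemma csumD I (m n : I -> R) : csum (fun i => m i + n i) = csum m + csum n.
Proof.
have [I0|I0] := pselect (inhabited I); last first.
  by rewrite !csum_empty ?addr0 // => i; apply: I0.
transitivity (csum (fun i => csum (fun b : bool => if b then m i else n i))).
  by congr csum; apply: funext => i; rewrite csum_bool.
by rewrite csum_exchange ?csum_bool //; exists; exact: true.
Qed.

Lemma csum_option I (m : option I -> R) : csum m = m None + csum (m \o some).
(* An empty [I] is treated apart, since it would give an empty block. *)
Proof.
have [I0|I0] := pselect (inhabited I); last first.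
  rewrite (csum_single _ _ None) => [|[i|//]]; last by case: I0.
  by rewrite csum_empty ?addr0 // => i; apply: I0.
pose K (b : bool) := if b return Type then unit else I.
pose h b : K b -> option I := if b is true then fun=> None else some.
rewrite (csum_blocks (h := h)) => [|[]|[]|[] []|[i|]] //; first last.
- by exists true, tt.
- by exists false, i.
- by move=> [] [].
rewrite csum_bool; congr (_ + _).
by apply: (csum_single _ _ tt) => -[].
Qed.

Lemma csumD1 I (m : I -> R) i : exists z, csum m = m i + z.
Proof.
pose h (k : option {k | k <> i}) := if k is Some k then sval k else i.
rewrite (csum_reindex (h := h)) ?csum_option => [|[[k ki]|] [[k' k'i]|] //=|k].
- by eexists.
- by move=> kk'; case: _ / kk' in k'i *; rewrite (Prop_irrelevance ki k'i).
- by move/esym.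
- have [->|ki] := pselect (k = i); first by exists None.
  by exists (Some (exist _ k ki)).
Qed.

(** Eilenberg swindle: the [nat]-fold sum of [x] absorbs one more [x], and together with the
    [nat]-fold sum of [y] it gives 0, so [x + 0 = 0]. *)
Lemma addr_eq0l x y : x + y = 0 -> x = 0.
Proof.
have E (z : R) : csum (fun _ : nat => z) = z + csum (fun _ : nat => z).
  pose h o := if o is Some n then S n else 0%N.
  rewrite [LHS](csum_reindex (h := h)) ?csum_option // =>
    [[n|] [n'|] //= [->] //|[|n]].
    by exists None.
  by exists (Some n).
move=> xy0; have: csum (fun _ : nat => x + y) = 0 by rewrite xy0 csum_zero.
by rewrite csumD => Exy; have := Exy; rewrite {1}E -addrA Exy addr0.
Qed.

Lemma csum_eq0 I (m : I -> R) : csum m = 0 <-> forall i, m i = 0.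
Proof.
split=> [m0 i|m0]; last first.
  by rewrite -[RHS](@csum_zero I); congr csum; apply: funext.
by have [z] := csumD1 m i; rewrite m0 => /esym/addr_eq0l.
Qed.

End CompleteSums.

(** * Types with at most two elements *)

Lemma card_le2 T (a b : T) : (forall x, x = a \/ x = b) -> [set: T] #<= `I_2.
Proof.
move=> ab; pose g k := if k is 0%N then a else b.
apply: card_le_trans (subset_card_le _) (card_image_le g _) => x _.
by have [->|->] := ab x; [exists 0%N|exists 1%N].
Qed.

Lemma card_le2P T (a b : T) :
  [set: T] #<= `I_2 -> a <> b -> forall x, x = a \/ x = b.
Proof.
move=> /pcard_leP[f] neq_ab x.
have f2 y : (f y < 2)%N by have := 'funS_f (Logic.I : [set: T] y).
have f_inj y z : f y = f z -> y = z by apply: 'inj_f; rewrite in_setT.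
have [] := (f2 a, f2 b); have := f2 x.
have : f a <> f b by move=> /f_inj.
case fx: (f x) => [|[|]] //; case fa: (f a) => [|[|]] //;
  case fb: (f b) => [|[|]] // _ _ _ _;
  by [left; apply: f_inj; rewrite fa|right; apply: f_inj; rewrite fb].
Qed.

(** * Left annihilators and minimal complete left ideals *)

Section Annihilators.
Variable R : completeHemiringType.
Implicit Types (x y z r : R) (L : set R).
Local Open Scope ring_scope.

Definition ann x : set R := [set r | (r * x)%g = 0].

Definition complete_left_ideal L :=
  left_ideal L /\ forall I (m : I -> R), (forall i, L (m i)) -> L (csum m).

Lemma ann0 : ann 0 = setT.
Proof. by apply/seteqP; split=> r // _; apply: hmulr0. Qed.

(** A sum vanishes only if all its terms do, by [csum_eq0]. *)
Lemma ann_csum I (m : I -> R) : ann (csum m) = \bigcap_i ann (m i).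
Proof.
apply/seteqP; split=> r; rewrite /ann /= hmul_csumr csum_eq0.
  by move=> rm i _; apply: rm.
by move=> rm i; apply: rm.
Qed.

Lemma annM r x : ann (r * x)%g = [set s | ann x (s * r)%g].
Proof. by apply/seteqP; split=> s; rewrite /ann /= mulgA. Qed.

Lemma ann_ideal x : complete_left_ideal (ann x).
Proof.
split; first split; rewrite /ann /=.
- exact: hmul0r.
- by move=> r s rx sx; rewrite hmulDl rx sx addr0.
- by move=> s r rx; rewrite -mulgA rx hmulr0.
by move=> I m mx; rewrite hmul_csuml csum_eq0.
Qed.

Lemma setT_ideal : complete_left_ideal setT.
Proof. by []. Qed.

Lemma mul_ideal L x : complete_left_ideal L ->
  complete_left_ideal [set (r * x)%g | r in L].
Proof.
move=> [[L0 LD LM] Lsum]; split; first split.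
- by exists 0 => //; apply: hmul0r.
- by move=> _ _ [r Lr <-] [s Ls <-]; exists (r + s); [apply: LD|apply: hmulDl].
- by move=> s _ [r Lr <-]; exists (s * r)%g; [apply: LM|rewrite mulgA].
move=> I m Lm; have /choice[r rP] i : exists r, L r /\ (r * x)%g = m i.
  by have [r] := Lm i; exists r.
exists (csum r); first by apply: Lsum => i; have [] := rP i.
by rewrite hmul_csuml; congr csum; apply: funext => i; have [] := rP i.
Qed.

Definition minimal_ideal L :=
  [/\ complete_left_ideal L, exists2 x, L x & x <> 0 &
      forall K, complete_left_ideal K -> K `<=` L ->
      (exists2 x, K x & x <> 0) -> K = L].

(** Without a minimal one, dependent choice from [setT] yields a strictly descending chain of
    complete left ideals, which are in particular left ideals. *)
Lemma minimal_ideal_exists : left_artinian R -> (exists x, x <> 0) ->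
  exists L, minimal_ideal L.
Proof.
move=> artR [x x0]; apply: contrapT => noL.
pose T := {L | complete_left_ideal L /\ exists2 x, L x & x <> 0}.
pose lt (K L : T) := sval K `<` sval L.
have lt_ex (L : T) : {K : T | lt K L}.
  apply: cid; case: L => L [Lid Ln0]; apply: contrapT => noK; apply: noL.
  exists L.
  split=> // K Kid KL Kn0; apply: contrapT => neKL; apply: noK.
  exists (exist _ K (conj Kid Kn0)); rewrite /lt properEneq.
  by split=> //; apply/eqP.
pose T0 : T := exist _ setT (conj setT_ideal (ex_intro2 _ _ x Logic.I x0)).
have [F [_ FS]] := dependent_choice lt_ex T0.
have [||N FN] := artR (fun n => sval (F n)).
- by move=> n; case: (F n) => L [[]].
- by move=> n; apply: properW (FS n).
by have := FS N; rewrite /lt properEneq FN ?leqnSn // eqxx => -[].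
Qed.

End Annihilators.

(** * Consequences of congruence-simplicity *)

Section CongruenceSimple.
Variable R : completeHemiringType.
Hypothesis simpleR : congruence_simple R.
Implicit Types (x y z r : R) (L : set R).
Local Open Scope ring_scope.

(* The relation "[x] and [y] have equal [K]-fold sums for some inhabited [K]"
   is a congruence; it relates [x] to its [I]-fold sum because
   [nat -> I] is in bijection with [(nat -> I) * I]. *)
Lemma csum_const I x : inhabited I -> csum (fun _ : I => x) = x.
Proof.
move=> [i0].
pose c K y := csum (fun _ : K => y).
pose e y z := exists K, inhabited K /\ c K y = c K z.
have prodR J K y : inhabited K -> c (J * K)%type y = c J (c K y).
  by move=> K0; exact: (csum_prod (fun _ _ => y)).
have prodL J K y : inhabited J -> inhabited K -> c (J * K)%type y = c K (c J y).
  by move=> J0 K0; rewrite prodR //; exact: (csum_exchange (fun _ _ => y)).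
have inh_prod J K : inhabited J -> inhabited K -> inhabited (J * K).
  by move=> [j] [k]; exists.
have [] := @simpleR e; first split.
- by move=> y; exists unit; split=> //; exists.
- by move=> y z [K [K0 yz]]; exists K.
- move=> y1 y2 y3 [J [J0 e12]] [K [K0 e23]]; exists (J * K)%type.
  split; first exact: inh_prod.
  by rewrite prodL // e12 -prodL // prodR // e23 -prodR.
- move=> y y' z z' [J [J0 ey]] [K [K0 ez]]; exists (J * K)%type.
  split; first exact: inh_prod.
  have cD k t : c (J * K)%type (k + t) = c (J * K)%type k + c (J * K)%type t.
    exact: csumD.
  by rewrite !cD prodL // ey -prodL // (prodR _ _ z) // ez -prodR.
- move=> y y' z z' [J [J0 ey]] [K [K0 ez]]; exists (J * K)%type.
  split; first exact: inh_prod.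
  have cM k t : c (J * K)%type (k * t)%g = (c J k * c K t)%g.
    rewrite prodR // /c hmul_csuml; congr csum; apply: funext => j.
    by rewrite hmul_csumr.
  by rewrite !cM ey ez.
- move=> eP; apply/eP; exists (nat -> I).
  have inh : inhabited (nat -> I) by exists.
  split=> //; rewrite -[LHS]prodR; last by exists.
  pose cons (p : (nat -> I) * I) n := if n is n'.+1 then p.1 n' else p.2.
  rewrite /c (csum_reindex (h := cons)) //.
    move=> [f i] [f' i'] /= fi; have := congr1 (@^~ 0%N) fi => /= ->.
    by congr (_, _); apply: funext => n; have := congr1 (@^~ n.+1) fi.
  by move=> f; exists (f \o S, f 0%N); apply: funext => -[].
(* If the congruence is total, some inhabited fold of each [z] is 0, so [R] is trivial. *)
- move=> eT; have z0 z : z = 0.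
    have [K [[k]]] := eT z 0; rewrite /c csum_zero => /csum_eq0; exact.
  by rewrite (z0 (csum _)) (z0 x).
Qed.

Lemma addr_idem x : x + x = x.
Proof.
by rewrite -[RHS](@csum_const bool) ?csum_bool //; exists; exact: true.
Qed.

Lemma csum_absorb I (m : I -> R) i : m i + csum m = csum m.
Proof. by have [z ->] := csumD1 m i; rewrite addrA addr_idem. Qed.

(** The sum absorbs [m i], itself the sum of a constant family; adding the two families termwise
    leaves [m i] at each index. *)
Lemma csum_max I (m : I -> R) i : (forall k, m k + m i = m i) -> csum m = m i.
Proof.
move=> mi; have I0 : inhabited I by exists.
rewrite -(csum_absorb m i) addrC -[X in _ + X](@csum_const I) // -csumD.
rewrite -[RHS](@csum_const I) //.
by congr csum; apply: funext => k.
Qed.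

Lemma card_le2_or_ann_proper :
  [set: R] #<= `I_2 \/ forall x, ann x = setT -> x = 0.
Proof.
have [] := @simpleR (fun x y => forall r, (r * x)%g = (r * y)%g);
  first split=> //.
- by move=> x y z xy yz r; rewrite xy.
- by move=> x x' y y' xx' yy' r; rewrite !hmulDr xx' yy'.
- by move=> x x' y y' xx' yy' r; rewrite !mulgA xx' -!mulgA yy' .
- move=> eP; right=> x annx; apply/eP => r; rewrite hmulr0.
  by have : ann x r by rewrite annx.
move=> eT; left; have mul0 x y : (x * y)%g = 0 by rewrite (eT y 0) hmulr0.
(* All products are 0 here, so the partition into 0 and the nonzero elements is a congruence; it
   respects sums because [x + y = 0] forces both terms to vanish. *)
have [] := @simpleR (fun x y => x = 0 <-> y = 0); first split=> //.
- by move=> x y [].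
- by move=> x y z -> ->.
- move=> x x' y y' xx' yy'; have D0 (u v : R) : u + v = 0 <-> u = 0 /\ v = 0.
    split=> [uv|[-> ->]]; last by rewrite addr0.
    by split; [exact: addr_eq0l uv|rewrite addrC in uv; exact: addr_eq0l uv].
  by rewrite !D0 xx' yy'.
- move=> eP; have [[a a0]|no] := pselect (exists x, x <> 0).
    apply: (card_le2 (a := 0) (b := a)) => x.
    have [|x0] := pselect (x = 0); first by left.
    by right; apply/(eP x a); split.
  apply: (card_le2 (a := 0) (b := 0)) => x; left.
  by apply: contrapT => x0; apply: no; exists x.
- move=> eT'; apply: (card_le2 (a := 0) (b := 0)) => x; left.
  exact/(eT' x 0).
Qed.

End CongruenceSimple.

(** * The complete lattice of a closure system *)

Section ClosureSystem.
Variable T : Type.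

(** The empty [D] is allowed, so [setT] lies in [C]; it becomes the bottom element. *)
Definition closed_bigcap (C : set (set T)) : Prop :=
  forall D : set (set T), D `<=` C -> C (\bigcap_(A in D) A).

Variables (C : set (set T)) (C_bigcap : closed_bigcap C).

(* Ordered by reverse inclusion, so that suprema are intersections. *)
Definition closure_lattice of closed_bigcap C := {A : set T | C A}.
Local Notation M := (closure_lattice C_bigcap).
Implicit Types (A B D : M) (F : set M).

HB.instance Definition _ := gen_eqMixin M.
HB.instance Definition _ := gen_choiceMixin M.

Definition closure_le A B : bool := `[< sval B `<=` sval A >].

Lemma closure_val_inj A B : sval A = sval B -> A = B.
Proof.
by case: A B => [A CA] [B CB] /= AB; case: _ / AB in CB *; congr exist.
Qed.

Fact closure_le_refl : reflexive closure_le.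
Proof. by move=> A; apply/asboolP. Qed.

Fact closure_le_anti : antisymmetric closure_le.
Proof.
move=> A B /andP[/asboolP BA /asboolP AB].
by apply: closure_val_inj; apply/seteqP.
Qed.

Fact closure_le_trans : transitive closure_le.
Proof.
move=> B A D /asboolP BA /asboolP DB; apply/asboolP.
exact: subset_trans DB BA.
Qed.

Fact closure_sup_subproof F : C (\bigcap_(A in F) sval A).
Proof.
rewrite -(bigcap_image F (fun A => sval A) id).
by apply: C_bigcap => _ [A _ <-]; apply: (svalP A).
Qed.

Definition closure_sup F : M := exist _ _ (closure_sup_subproof F).

HB.instance Definition _ := Order.Le_isPOrder.Build (Order.Disp tt tt) M
  closure_le_refl closure_le_anti closure_le_trans.

Lemma closure_leP A B : reflect (sval B `<=` sval A) (A <= B)%O.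
Proof. exact: asboolP. Qed.

Lemma closure_sup_le F B :
  (closure_sup F <= B)%O <-> (forall A, F A -> (A <= B)%O).
Proof.
split=> [/closure_leP FB A FA|FB]; apply/closure_leP => t Bt; first exact: FB.
by move=> A /FB /closure_leP; apply.
Qed.

Definition closure_join A B := closure_sup [set A; B].
(** A union of members of [C] may fall outside [C], hence the detour through lower bounds. *)
Definition closure_meet A B := closure_sup [set D | (D <= A)%O /\ (D <= B)%O].

Fact closure_meetP A B D : (A <= closure_meet B D)%O = (A <= B)%O && (A <= D)%O.
Proof.
have lbB : (closure_meet B D <= B)%O by apply/closure_sup_le => E [].
have lbD : (closure_meet B D <= D)%O by apply/closure_sup_le => E [].
apply/idP/andP=> [A_le|[AB AD]]; first by split; apply: le_trans A_le _.
exact: ((closure_sup_le _ _).1 (lexx _) A (conj AB AD)).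
Qed.

Fact closure_joinP A B D : (closure_join A B <= D)%O = (A <= D)%O && (B <= D)%O.
Proof.
apply/idP/andP=> [/closure_sup_le le|[AD BD]].
  by split; apply: le; [left|right].
by apply/closure_sup_le => E [->|->].
Qed.

HB.instance Definition _ := Order.POrder_MeetJoin_isLattice.Build
  (Order.Disp tt tt) M closure_meetP closure_joinP.

Fact closure_le0 A : (closure_sup set0 <= A)%O.
Proof. exact/closure_sup_le. Qed.

Fact closure_le1 A : (A <= closure_sup setT)%O.
Proof. exact: ((closure_sup_le _ _).1 (lexx _)). Qed.

HB.instance Definition _ :=
  Order.hasBottom.Build (Order.Disp tt tt) M closure_le0.
HB.instance Definition _ :=
  Order.hasTop.Build (Order.Disp tt tt) M closure_le1.

Definition closure_inf F := closure_sup (lbound F).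

Fact closure_supP F : supremums F (closure_sup F).
Proof.
split; first exact: ((closure_sup_le _ _).1 (lexx _)).
by move=> B FB; apply/closure_sup_le.
Qed.

Fact closure_infP F : infimums F (closure_inf F).
Proof.
split=> [A FA|B FB]; first by apply/closure_sup_le => B; apply.
exact: ((closure_sup_le _ _).1 (lexx _)).
Qed.

HB.instance Definition _ := isCompleteLattice.Build (Order.Disp tt tt) M
  closure_supP closure_infP.

Lemma val_csup F : sval (csup F) = \bigcap_(A in F) sval A.
Proof. by []. Qed.

Lemma val_bot : sval (\bot%O : M) = setT.
Proof. by apply/seteqP; split=> // t _ A []. Qed.

End ClosureSystem.

(** * The action of [R] on the annihilators of elements of [L] *)

Section Representation.
Variables (R : completeHemiringType) (L : set R).
Hypothesis idealL : complete_left_ideal L.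
Local Open Scope ring_scope.

(** By [ann_csum], the intersection is the annihilator of a sum of chosen representatives, which
    stays in the complete ideal [L]. *)
Lemma ann_bigcap : closed_bigcap (@ann R @` L).
Proof.
move=> D DL; have /choice[m mP] (A : D) : exists x, L x /\ ann x = set_val A.
  by have [x Lx xA] := DL _ (set_valP A); exists x.
exists (csum m); first by apply: idealL.2 => A; have [] := mP A.
rewrite ann_csum; apply/seteqP; split=> r rD.
  move=> A DA; have [_ mA] := mP (SigSub (mem_set DA)).
  have {}mA : _ = A := mA; rewrite -mA; exact: rD.
by move=> A _; have [_ ->] := mP A; apply: rD; apply: set_valP.
Qed.

(* The quotient of the [R]-module [L] by the congruence [ann x = ann y]. *)
Local Notation M := (closure_lattice ann_bigcap).

Lemma ann_latticeP (A : M) : exists2 x, L x & sval A = ann x.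
Proof. by have [x Lx xA] := svalP A; exists x. Qed.

Definition ann_class x (Lx : L x) : M := exist _ _ (imageP (@ann R) Lx).

(** The formula mentions only the set [A], so the action is well defined; by [annM] it sends the
    class of [x] to that of [r * x]. *)
Fact ann_act_subproof (r : R) (A : M) :
  (@ann R @` L) [set s | sval A (s * r)%g].
Proof.
have [x Lx ->] := ann_latticeP A; rewrite -annM.
by exists (r * x)%g => //; case: idealL => -[_ _ LM] _; apply: LM.
Qed.

Definition ann_act_fun (r : R) (A : M) : M := exist _ _ (ann_act_subproof r A).

Fact ann_act_csup (r : R) (F : set M) :
  ann_act_fun r (csup F) = csup (ann_act_fun r @` F).
Proof. by apply: closure_val_inj; rewrite val_csup bigcap_image. Qed.

Definition ann_act (r : R) : cend M := CEnd (ann_act_csup r).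

Lemma ann_actE r (A : M) x :
  sval A = ann x -> sval (ann_act r A) = ann (r * x)%g.
Proof. by move=> Ax; rewrite annM /= Ax. Qed.

Lemma ann_act_csum I (m : I -> R) : ann_act (csum m) = csum (ann_act \o m).
Proof.
apply: cendP => A; apply: closure_val_inj; have [x _ Ax] := ann_latticeP A.
rewrite (ann_actE _ Ax) hmul_csuml ann_csum val_csup bigcap_image.
by apply: eq_bigcapr => i _; rewrite -(ann_actE _ Ax).
Qed.

(** Zero and binary addition are sums over [False] and [bool], so [ann_act_csum] covers them. *)
Lemma ann_act_hom : complete_hom ann_act.
Proof.
split.
- rewrite -[0 in LHS](@csum_empty R False (fun=> 0) id) ann_act_csum.
  exact: csum_empty.
- move=> r s.
  transitivity (ann_act (csum (fun b : bool => if b then r else s))).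
    by rewrite csum_bool.
  by rewrite ann_act_csum csum_bool.
- move=> r s; apply: cendP => A; apply: closure_val_inj.
  by apply/seteqP; split=> t /=; rewrite mulgA.
- by move=> I m; apply: ann_act_csum.
Qed.

Lemma ann_lattice_noetherian : left_artinian R -> noetherian M.
Proof.
move=> artR u u_incr.
have [||N uN] := artR (fun n => sval (u n)).
- by move=> n; have [x _ ->] := ann_latticeP (u n); case: (ann_ideal x).
- by move=> n; apply/closure_leP/u_incr.
by exists N => n Nn; apply/closure_val_inj/uN.
Qed.

Hypothesis minL : minimal_ideal L.
Hypothesis ann_proper : forall x : R, ann x = setT -> x = 0.

(** The multiples of [x] by [K] form a nonzero complete left ideal inside [L], hence all of [L]. *)
Lemma mul_minimal_ideal (K : set R) (x y : R) :
    complete_left_ideal K -> L x -> L y ->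
    (exists2 r, K r & (r * x)%g <> 0) ->
  exists2 r, K r & (r * x)%g = y.
Proof.
move=> idK Lx Ly [r Kr rx]; have [[[_ _ LM] _] _ min] := minL.
suff KxL : [set (r * x)%g | r in K] = L by have : L y by []; rewrite -KxL.
apply: min; first exact: mul_ideal.
  by move=> _ [s Ks <-]; apply: LM.
by exists (r * x)%g => //; exists r.
Qed.

Lemma ann_act_dense : congruence_simple R -> cend_dense (range ann_act).
Proof.
move=> simpleR A B; have [x Lx Ax] := ann_latticeP A.
have [y Ly By] := ann_latticeP B; have [[[L0 _ LM] Lsum] [z Lz z0] _] := minL.
(* [w] is the top of [L] for the order in which [u] is below [v] when [u + v = v]. *)
pose w := csum (fun x : L => set_val x : R).
have Lw : L w by apply: Lsum => i; apply: set_valP.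
have leLw v : L v -> v + w = w.
  move=> Lv.
  have := csum_absorb simpleR (fun x : L => set_val x : R).
  exact: (@^~ (SigSub (mem_set Lv))).
(* [s] will kill each [v] annihilated by [ann x] and send every other [v] of [L] to [w]; then [t]
   moves [w] to [y]. *)
pose s := csum (fun r : ann x => set_val r : R).
have [t _ tw] : exists2 t, setT t & (t * w)%g = y.
  apply: mul_minimal_ideal => //; apply: contrapT => Rw; apply: z0.
  have w0 : w = 0.
    apply: ann_proper; apply/seteqP; split=> r // _; apply: contrapT => rw.
    by apply: Rw; exists r.
  by rewrite -[z]addr0 -w0 leLw.
exists (t * s)%g => //; apply: cendP => D; apply: closure_val_inj.
have [v Lv Dv] := ann_latticeP D; rewrite (ann_actE _ Dv) -mulgA.
have -> : (s * v)%g = csum (fun r : ann x => (set_val r * v)%g).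
  exact: hmul_csuml.
rewrite /=; case: ifPn => [/closure_leP|] DA.
  rewrite val_bot [csum _](_ : _ = 0) ?hmulr0 ?ann0 //.
  by apply/csum_eq0 => r; rewrite Ax Dv in DA; exact: DA (set_valP r).
(* Some element of [ann x] does not kill [v], so by minimality one reaches [w]; this greatest term
   is then the whole sum. *)
have [r xr rv] : exists2 r, ann x r & (r * v)%g = w.
  apply: mul_minimal_ideal => //; first exact: ann_ideal.
  apply: contrapT => no; move/negP: DA; apply; apply/closure_leP => r.
  rewrite Ax Dv => xr; apply: contrapT => rv; apply: no; by exists r.
rewrite (@csum_max _ simpleR _ _ (SigSub (mem_set xr))) /=.
  by rewrite set_valE /= rv tw By.
by move=> k; rewrite {2 3}set_valE /= rv; apply: leLw; apply: LM.
Qed.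

(** Were the kernel congruence total, every [r] would act as 0; [ann_proper] then gives [r * x = 0]
    for all [r], and once more [x = 0]. *)
Lemma ann_act_inj : congruence_simple R -> injective ann_act.
Proof.
move=> simpleR; have [act0 actD actM _] := ann_act_hom.
have [] := @simpleR (fun r s => ann_act r = ann_act s); first split=> //.
- by move=> r s t -> ->.
- by move=> r r' s s' rr' ss'; rewrite !actD rr' ss'.
- by move=> r r' s s' rr' ss'; rewrite !actM rr' ss'.
- by move=> eP r s /eP.
move=> eT; have [_ [x Lx x0] _] := minL; case: x0.
apply: ann_proper; apply/seteqP; split=> r // _; apply: ann_proper.
have := congr1 (fun f : cend M => sval (f (ann_class Lx))) (eT r 0).
by rewrite !(@ann_actE _ _ x) // hmul0r ann0.
Qed.

Lemma ann_lattice_nonzero : exists A : M, A <> \bot%O.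
Proof.
have [_ [x Lx x0] _] := minL; exists (ann_class Lx) => xbot; apply: x0.
apply: ann_proper; rewrite -(val_bot ann_bigcap) -xbot //.
Qed.

End Representation.

(** * Images of complete homomorphisms, and simplicity of dense hemirings *)

Lemma hom_range_subhemiring (R R' : completeHemiringType) (f : R -> R') :
  complete_hom f -> complete_subhemiring (range f).
Proof.
move=> [f0 fD fM fsum]; split; first split.
- by exists 0%R.
- by move=> _ _ [x _ <-] [y _ <-]; exists (x + y)%R.
- by move=> _ _ [x _ <-] [y _ <-]; exists (x * y)%g.
move=> I m fm; have /choice[x xm] i : exists x, f x = m i.
  by have [x] := fm i; exists x.
exists (csum x) => //; rewrite fsum.
by congr csum; apply: funext => i; apply: xm.
Qed.

(* [e_{g x, b} f e_{c, x} = e_{c, b}] whenever [f x] is not below [g x], so a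
   nontrivial congruence relates all [e_{c, b}] to 0, among them the greatest
   endomorphism [e_{0, 1}], which absorbs all others. *)
Lemma dense_congruence_simple (R : completeHemiringType) d
    (M : completeLatticeType d) (S : set (cend M)) :
  cend_dense S -> complete_isomorphic R S -> congruence_simple R.
Proof.
move=> denseS [phi [[phi0 phiD phiM _] [_ phi_inj phi_surj]]] e.
move=> [eR eS eT eD eM].
have {}phi_inj x y : phi x = phi y -> x = y by apply: phi_inj; rewrite in_setT.
have /choice[E EP] (ab : M * M) : exists r, phi r = cend_e ab.1 ab.2.
  by have [r] := phi_surj _ (denseS ab.1 ab.2); exists r.
have [diag|ndiag] := pselect (forall x y, e x y -> x = y).
  by left=> x y; split=> [/diag|->].
right; suff e0 r : e r 0%R by move=> x y; apply: eT (e0 x) (eS _ _ (e0 y)).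
have [f [g [efg [x fgx]]]] :
    exists f g, e f g /\ exists x, ~~ (phi f x <= phi g x)%O.
  apply: contrapT => no; apply: ndiag => f g efg; apply/phi_inj/cendP => x.
  apply/le_anti/andP; split; apply: contrapT => /negP fgx; apply: no.
    by exists f, g; split=> //; exists x.
  by exists g, f; split; [exact: eS|exists x].
pose h k := (E (phi g x, \top%O) * (k * E (\bot%O, x)))%g.
have hE k z : phi (h k) z =
    if (z <= \bot)%O then \bot%O
    else if (phi k x <= phi g x)%O then \bot%O else \top%O.
  rewrite /h !phiM /= !EP /=; have [_|_] //= := boolP (z <= \bot)%O.
  by rewrite cend0 le0x.
have efg' : e (h f) (h g) by do 2?apply: (eM) => //.
have hg : h g = 0%R.
  by apply/phi_inj/cendP => z; rewrite hE phi0 lexx; case: ifP.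
have hf : (r + h f = h f)%R.
  apply/phi_inj/cendP => z; rewrite phiD /= hE (negbTE fgx).
  case: ifP => [|_]; last by rewrite joinx1.
  by rewrite lex0 => /eqP->; rewrite cend0 joinxx.
(* Adding [r] to both sides of the relation between [h f] and 0 relates [h f] to [r]. *)
rewrite hg in efg'; have := eD _ _ _ _ (eR r) efg'; rewrite hf addr0 => rh.
exact: eT (eS _ _ rh) efg'.
Qed.

Lemma card_le2_congruence_simple (R : completeHemiringType) :
  [set: R] #<= `I_2 -> congruence_simple R.
Proof.
move=> R2 e [eR eS _ _ _].
have [diag|ndiag] := pselect (forall x y, e x y -> x = y).
  by left=> x y; split=> [/diag|->].
right; have [a [b [eab neq_ab]]] : exists a b, e a b /\ a <> b.
  apply: contrapT => no; apply: ndiag => x y exy; apply: contrapT => xy.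
  by apply: no; exists x, y.
move=> x y; have := card_le2P R2 neq_ab.
by move=> ab; have [->|->] := ab x; have [->|->] := ab y => //; apply: eS.
Qed.

Theorem corollary4p7 (R : completeHemiringType) (hR : left_artinian R) :
  congruence_simple R <->
  ([set: R] #<= `I_2 \/
   exists (d : Order.disp_t) (M : completeLatticeType d) (S : set (cend M)),
     (exists x : M, x <> Order.bottom) /\
     noetherian M /\
     complete_subhemiring S /\
     cend_dense S /\
     complete_isomorphic R S).
Proof.
split; last first.
  case=> [|[d [M [S [_ [_ [_ [denseS isoS]]]]]]]].
    exact: card_le2_congruence_simple.
  exact: dense_congruence_simple isoS.
move=> simpleR.
have [|ann_proper] := card_le2_or_ann_proper simpleR; first by left.
(* The zero hemiring has no nonzero ideal and falls under the cardinality alternative. *)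
have [R0|nR0] := pselect (forall x : R, x = 0%R).
  by left; apply: (card_le2 (a := 0%R) (b := 0%R)) => x; left.
right; have [L minL] : exists L : set R, minimal_ideal L.
  apply: minimal_ideal_exists => //; apply: contrapT => no; apply: nR0 => x.
  by apply: contrapT => x0; apply: no; exists x.
have [idL _ _] := minL; have homL := ann_act_hom idL.
exists _, (closure_lattice (ann_bigcap idL)), (range (ann_act idL)).
split; first exact: ann_lattice_nonzero.
split; first exact: ann_lattice_noetherian.
split; first exact: hom_range_subhemiring.
split; first exact: ann_act_dense.
exists (ann_act idL); split=> //; split=> [r _|r s _ _|//]; first by exists r.
exact: ann_act_inj.
Qed.
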